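(* Let $\mathcal{G}_o$ be a tree on $\{0,1,\dots,N\}$ rooted at node $0$ (the substation), with positive line resistances and reduced weighted Laplacian $\mathbf{\Theta}_o\in\mathbb{R}^{N\times N}$, and let $\mathcal{F}$ be its set of leaf nodes. Let $\mathcal{C}\subseteq\{1,\dots,N\}$ with $C:=|\mathcal{C}|$ be the set of probed buses, let $\mathbf{\Delta}\in\mathbb{R}^{C\times T}$ satisfy $\mathrm{rank}(\mathbf{\Delta})=C$, and let $\tilde{\mathbf{V}}=\mathbf{\Theta}_o^{-1}\mathbf{I}_{\mathcal{C}}\mathbf{\Delta}\in\mathbb{R}^{N\times T}$ be the (noiseless) voltage data collected at all nodes. If the grid is probed at all leaf nodes, that is $\mathcal{F}\subseteq\mathcal{C}$, then the resistive network topology is identifiable from $(\tilde{\mathbf{V}},\mathbf{\Delta})$: there is no $\mathbf{\Theta}\in\mathcal{M}\cap\mathcal{T}$ with $\mathbf{\Theta}\neq\mathbf{\Theta}_o$ and $\mathbf{\Theta}^{-1}\mathbf{I}_{\mathcal{C}}\mathbf{\Delta}=\mathbf{\Theta}_o^{-1}\mathbf{I}_{\mathcal{C}}\mathbf{\Delta}$; equivalently, $\mathbf{\Theta}_o$ is the unique minimizer of $$\min_{\mathbf{\Theta}\in\mathcal{M}\cap\mathcal{T}}\ \tfrac12\|\mathbf{\Theta}\tilde{\mathbf{V}}-\mathbf{I}_{\mathcal{C}}\mathbf{\Delta}\|_{\mathbf{W}}^2 .$$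
   Context: A leaf of a rooted tree is a node having no descendants other than itself, where $m$ is a descendant of $n$ if $n$ lies on the path from the root $0$ to $m$. Reduced weighted Laplacian: if $\tilde{\mathbf{A}}=[\mathbf{a}_0\ \mathbf{A}]\in\{0,\pm1\}^{N\times(N+1)}$ is the branch-bus incidence matrix of the tree (the row of a line has a $+1$ and a $-1$ at its two end nodes and zeros elsewhere; columns indexed by nodes $0,\dots,N$, with $\mathbf{a}_0$ the column of node $0$) and $\mathbf{r}$ is the vector of positive line resistances, then $\mathbf{\Theta}_o=\mathbf{A}^\top\mathrm{diag}(\mathbf{r})^{-1}\mathbf{A}$. It is symmetric positive definite. $\mathbf{I}_{\mathcal{C}}$ is the $N\times C$ matrix whose columns are the canonical vectors $\mathbf{e}_m\in\mathbb{R}^N$, $m\in\mathcal{C}$. $\mathbf{W}\succ\mathbf{0}$ is a fixed $N\times N$ weighting matrix and $\|\mathbf{X}\|_{\mathbf{W}}^2:=\mathrm{Tr}(\mathbf{X}^\top\mathbf{W}\mathbf{X})$. Prior information: $\tilde{\mathbf{\Gamma}}$ is a fixed symmetric $(N+1)\times(N+1)$ $0/1$ matrix (indices $0,\dots,N$), with $[\tilde\Gamma]_{mn}=0$ if line $(m,n)$ is known to be non-energized (i.e. known not to be an edge of $\mathcal{G}_o$) and $[\tilde\Gamma]_{mn}=1$ if there is no prior information on line $(m,n)$. The prior information is correct, so $\mathbf{\Theta}_o\in\mathcal{M}\cap\mathcal{T}$. $\mathcal{M}$ is the set of symmetric $\mathbf{\Theta}\in\mathbb{R}^{N\times N}$ such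 that, for all $m\ne n$ in $\{1,\dots,N\}$, $\Theta_{mn}\le0$ if $[\tilde\Gamma]_{mn}=1$ and $\Theta_{mn}=0$ if $[\tilde\Gamma]_{mn}=0$; and, for all $n\in\{1,\dots,N\}$, $\mathbf{e}_n^\top\mathbf{\Theta}\mathbf{1}\ge0$ if $[\tilde\Gamma]_{0n}=1$ and $\mathbf{e}_n^\top\mathbf{\Theta}\mathbf{1}=0$ if $[\tilde\Gamma]_{0n}=0$. $\mathcal{T}:=\{\mathbf{\Theta}:\|\mathbf{\Phi}(\mathbf{\Theta})\|_{0,\mathrm{off}}=2N,\ \mathbf{\Theta}\succ\mathbf{0}\}$, where $\mathbf{\Phi}(\mathbf{\Theta}):=\begin{bmatrix}\mathbf{1}^\top\mathbf{\Theta}\mathbf{1}&-\mathbf{1}^\top\mathbf{\Theta}\\-\mathbf{\Theta}\mathbf{1}&\mathbf{\Theta}\end{bmatrix}$ and $\|\cdot\|_{0,\mathrm{off}}$ counts the nonzero off-diagonal entries. *)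

(* Defs.v *)
From mathcomp Require Import all_boot all_order all_algebra.
From mathcomp Require Import reals.

Set Implicit Arguments.
Unset Strict Implicit.
Unset Printing Implicit Defensive.

Import Order.TTheory GRing.Theory Num.Theory.
Local Open Scope ring_scope.

(* Nodes are 'I_N.+1, the root (substation) being ord0.  The buses 1, .., N
   are represented by 'I_N: bus i is node i + 1. *)
Notation bus := (lift ord0).

Section Trees.
Variable N : nat.
Implicit Types (e : rel 'I_N.+1) (m n : 'I_N.+1).

Definition simple_graph e : Prop := symmetric e /\ irreflexive e.

Definition connected_graph e : Prop := forall m n, connect e m n.

(* The bound on the size discards the closed walks m, n, m along one edge. *)
Definition acyclic_graph e : Prop :=
  forall c : seq 'I_N.+1, (2 < size c)%N -> ~ ucycle e c.

Definition is_tree e : Prop :=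
  [/\ simple_graph e, connected_graph e & acyclic_graph e].

(* [ord0 :: p] is a simple path from the root to m; in a tree it is the only
   one. *)
Definition root_path e m (p : seq 'I_N.+1) : Prop :=
  [/\ path e ord0 p, uniq (ord0 :: p) & last ord0 p = m].

Definition descendant e n m : Prop :=
  exists p, root_path e m p /\ n \in ord0 :: p.

Definition leaf e n : Prop := forall m, descendant e n m -> m = n.

End Trees.

Section Matrices.
Variables (R : realType) (N : nat).
Implicit Types (Th W : 'M[R]_N) (G : 'M[bool]_N.+1) (At : 'M[R]_(N, N.+1)).

Definition line_joins At (l : 'I_N) (m n : 'I_N.+1) : Prop :=
  row l At = delta_mx 0 m - delta_mx 0 n \/
  row l At = delta_mx 0 n - delta_mx 0 m.

(* The lines are numbered by 'I_N and oriented, both arbitrarily. *)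
Definition incidence_matrix (e : rel 'I_N.+1) At : Prop :=
  (forall l, exists m n, e m n /\ line_joins At l m n) /\
  (forall m n, e m n -> exists! l, line_joins At l m n).

Definition reduced_laplacian At (r : 'rV[R]_N) : 'M[R]_N :=
  let A := col' ord0 At in A^T *m invmx (diag_mx r) *m A.

Definition posdef Th : Prop :=
  Th^T = Th /\ forall x : 'cV[R]_N, x != 0 -> 0 < (x^T *m Th *m x) 0 0.

(* The columns of the matrix I_C are the e_m, m in C. *)
Definition probe_mx (C : {set 'I_N}) : 'M[R]_(N, #|C|) :=
  \matrix_(i, j) (i == enum_val j)%:R.

Definition ones : 'cV[R]_N := const_mx 1.

Definition extended_laplacian Th : 'M[R]_(1 + N) :=
  block_mx (ones^T *m Th *m ones) (- (ones^T *m Th))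
           (- (Th *m ones))       Th.

Definition norm0off (k : nat) (X : 'M[R]_k) : nat :=
  #|[set ij : 'I_k * 'I_k | (ij.1 != ij.2) && (X ij.1 ij.2 != 0)]|.

(* The 0/1 matrix of prior information is boolean: [G m n = false] when line
   (m, n) is known to be non-energized, [G m n = true] when nothing is known. *)
Definition correct_prior (e : rel 'I_N.+1) G : Prop :=
  G^T = G /\ forall m n, G m n = false -> ~~ e m n.

Definition feasM G Th : Prop :=
  [/\ Th^T = Th,
      forall m n : 'I_N, m != n ->
        (G (bus m) (bus n) = true -> Th m n <= 0) /\
        (G (bus m) (bus n) = false -> Th m n = 0)
    & forall n : 'I_N,
        (G ord0 (bus n) = true -> 0 <= (Th *m ones) n 0) /\
        (G ord0 (bus n) = false -> (Th *m ones) n 0 = 0)].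

Definition feasT Th : Prop :=
  norm0off (extended_laplacian Th) = (2 * N)%N /\ posdef Th.

Definition sqnormW W (T : nat) (X : 'M[R]_(N, T)) : R := \tr (X^T *m W *m X).

(* [invmx Th] is the actual inverse wherever this is used: Th is positive
   definite. *)
Definition voltage Th (C : {set 'I_N}) (T : nat) (D : 'M[R]_(#|C|, T)) :
    'M[R]_(N, T) :=
  invmx Th *m probe_mx C *m D.

Definition objective W (C : {set 'I_N}) (T : nat) (D : 'M[R]_(#|C|, T))
    (V : 'M[R]_(N, T)) Th : R :=
  2^-1 * sqnormW W (Th *m V - probe_mx C *m D).

End Matrices.

Definition minimizer (R : realType) (X : Type) (S : X -> Prop) (f : X -> R)
    (x : X) : Prop :=
  S x /\ forall y, S y -> f x <= f y.

(* Main.v *)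
Require Import Defs.
From mathcomp Require Import all_boot all_order all_algebra.
From mathcomp Require Import reals.

Set Implicit Arguments.
Unset Strict Implicit.
Unset Printing Implicit Defensive.

Import Order.TTheory GRing.Theory Num.Theory.
Local Open Scope ring_scope.

(** The entry (a, b) of the inverse of a reduced tree Laplacian is the total
    resistance of the lines shared by the paths from a and from b to the root.
    Call it X a b.  Paths to the root merge once and for all, so X is
    ultrametric: X a b is at least the minimum of X a m and X b m.  Moreover
    X a m = X a a exactly when a lies on the path from m to the root, and then
    X a b = min (X a m) (X b m) for every b ([shared_res_min]).  Hence X is
    determined by its columns in any set F of nodes meeting the descendants of
    every node; the leaves of the tree are such a set.

    The voltage data give the columns of the inverse of Tho indexed by the
    probed buses, since D has full row rank.  A competitor Th explaining the
    same data has the same columns, but its tree could be different and have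
    other leaves, so it must be shown that F also meets the descendants of
    every node in the tree of Th.  If it missed those of a, then a and its
    parent would have equal entries in all columns of F.  But in the tree of
    Tho these columns separate the nodes, because the deeper one of two nodes
    has a descendant in F, and the ultrametric inequality then forces the two
    nodes to coincide.  This is [shared_res_determined].

    It remains to see every feasible Th as the Laplacian of a rooted tree
    ([feasible_parent_map]).  Positive definiteness makes every node reachable
    from the root in the support graph of the extended Laplacian.  A
    breadth-first search gives a parent to every other node, hence N distinct
    edges, and the condition on the number of nonzero entries leaves no room
    for others.  The same applies to Tho, whose feasibility is checked
    directly. *)

(** * Rooted trees given by parent maps *)

(** The strictly decreasing rank [d] makes iteration of [p] reach the root, so
    that [p] is a tree; ancestors are then given by [fconnect p], which is
    reflexive.  The root is its own parent. *)
Definition parent_map (N : nat) (p : 'I_N.+1 -> 'I_N.+1) (d : 'I_N.+1 -> nat) :=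
  p ord0 = ord0 /\ forall i, i != ord0 -> (d (p i) < d i)%N.

Section ParentMap.
Variables (N : nat) (p : 'I_N.+1 -> 'I_N.+1) (d : 'I_N.+1 -> nat).
Hypothesis pm : parent_map p d.

Lemma fconnect_from_root c : fconnect p ord0 c = (c == ord0).
Proof.
have [p0 _] := pm.
apply/idP/eqP => [/iter_findex <- | ->]; last exact: connect0.
by elim: (findex _ _ _) => //= k ->.
Qed.

Lemma fconnect_rank a c : fconnect p a c -> a != c -> (d c < d a)%N.
Proof.
have [p0 dp] := pm.
have le_d k i : (d (iter k p i) <= d i)%N.
  elim: k => //= k IHk; apply: leq_trans _ IHk.
  by have [-> | /dp/ltnW//] := eqVneq (iter k p i) ord0; rewrite p0.
rewrite fconnect_eqVf => /orP[/eqP-> | pac]; first by rewrite eqxx.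
move=> a_neq_c; have a_neq0 : a != ord0.
  by apply: contra_neq a_neq_c => a0; move: pac; rewrite a0 p0 fconnect_from_root => /eqP.
by apply: leq_ltn_trans (dp _ a_neq0); rewrite -(iter_findex pac).
Qed.

Lemma fconnect_root a : fconnect p a ord0.
Proof.
have [k] := ubnP (d a); elim: k a => // k IHk a; rewrite ltnS => le_dak.
have [-> | /pm.2 lt_d] := eqVneq a ord0; first exact: connect0.
rewrite fconnect_eqVf IHk ?orbT //; exact: leq_trans lt_d le_dak.
Qed.

Lemma fconnect_anti a b : fconnect p a b -> fconnect p b a -> a = b.
Proof.
move=> ab ba; apply/eqP/negPn/negP => neq_ab.
have := fconnect_rank ab neq_ab; rewrite eq_sym in neq_ab.
by move/ltn_trans/(_ (fconnect_rank ba neq_ab)); rewrite ltnn.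
Qed.

(** The ancestors of [m] are the iterates of [p] at [m], hence totally
    ordered. *)
Lemma fconnect_chain m a b :
  fconnect p m a -> fconnect p m b -> fconnect p a b || fconnect p b a.
Proof.
move=> /iter_findex <- /iter_findex <-.
move: (findex p m a) (findex p m b) => i j.
have [le|/ltnW le] := leqP i j; first by rewrite -(subnK le) iterD fconnect_iter.
by rewrite -(subnK le) iterD fconnect_iter orbT.
Qed.

Lemma fconnect_parentN a : a != ord0 -> ~~ fconnect p (p a) a.
Proof.
move=> a_neq0; apply/negP => paa; have lt_d := pm.2 a a_neq0.
have [eq_pa | neq_pa] := eqVneq (p a) a; first by rewrite eq_pa ltnn in lt_d.
by have := ltn_trans lt_d (fconnect_rank paa neq_pa); rewrite ltnn.
Qed.

(** A descendant of maximal rank has no child. *)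
Lemma deepest_descendant a :
  exists2 m, fconnect p m a & forall k, p k = m -> k = m.
Proof.
case: (arg_maxnP (P := fun m => fconnect p m a) d (connect0 _ a)) => m ma max_m.
exists m => // k pkm; apply/eqP/negPn/negP => km.
have pk : fconnect p k m by rewrite -pkm fconnect1.
have : (d k <= d m)%N := max_m k (connect_trans pk ma).
by rewrite leqNgt (fconnect_rank pk km).
Qed.

(** * Resistance shared by two paths to the root *)

Section SharedResistance.
Variables (R : realType) (w : 'rV[R]_N).
Hypothesis w_gt0 : forall c, 0 < w 0 c.

(** The line from bus [c] to its parent has resistance [w 0 c], and the lines of
    the path from a node to the root are indexed by its non-root ancestors. *)
Definition shared_res a b : R :=
  \sum_(c | fconnect p a (bus c) && fconnect p b (bus c)) w 0 c.

Lemma shared_resC a b : shared_res a b = shared_res b a.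
Proof. by apply: eq_bigl => c; rewrite andbC. Qed.

Lemma ler_sum_weights (P Q : pred 'I_N) : (forall c, P c -> Q c) ->
  \sum_(c | P c) w 0 c <= \sum_(c | Q c) w 0 c.
Proof.
move=> PQ; rewrite (bigID P Q) /= (eq_bigl P); last first.
  by move=> c; rewrite andbC; case: (boolP (P c)) => //= /PQ.
by rewrite lerDl sumr_ge0 // => c _; apply: ltW.
Qed.

Lemma shared_res_le a b : shared_res a b <= shared_res a a.
Proof. by apply: ler_sum_weights => c /andP[-> _]. Qed.

Lemma shared_res_root b : shared_res ord0 b = 0.
Proof.
by apply: big_pred0 => c; rewrite fconnect_from_root.
Qed.

Lemma shared_res_ancestor m a :
  fconnect p m a -> shared_res a m = shared_res a a.
Proof.
move=> ma; apply: eq_bigl => c; rewrite andbb andb_idr //.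
exact: connect_trans ma.
Qed.

Lemma shared_res_parent a m : ~~ fconnect p m a ->
  shared_res (p a) m = shared_res a m.
Proof.
move=> nma; apply: eq_bigl => c; rewrite (fconnect_eqVf p a).
by case: eqP => //= <-; rewrite (negbTE nma) !andbF.
Qed.

(** Within the chain of ancestors of [m], those of [a] and those of [b] form two
    upper segments; one of them is contained in the other. *)
Lemma shared_res_ultrametric a b m :
  Num.min (shared_res a m) (shared_res b m) <= shared_res a b.
Proof.
(* Two buses c and k refuting both inclusions are comparable, as ancestors of m. *)
suff /orP[|] : [forall c : 'I_N, fconnect p a (bus c) && fconnect p m (bus c)
                 ==> fconnect p b (bus c)] ||
         [forall c : 'I_N, fconnect p b (bus c) && fconnect p m (bus c)
                 ==> fconnect p a (bus c)].
- move=> /forallP sub; rewrite ge_min; apply/orP; left.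
  by apply: ler_sum_weights => c am; have := sub c; rewrite am /= => ->; case/andP: am => ->.
- move=> /forallP sub; rewrite ge_min; apply/orP; right.
  by apply: ler_sum_weights => c bm; have := sub c; rewrite bm /= => ->; case/andP: bm => ->.
apply/negPn/negP; rewrite negb_or => /andP[/forallPn[c] + /forallPn[k]].
rewrite !negb_imply => /andP[/andP[ac mc] nbc] /andP[/andP[bk mk] nak].
have /orP[ck | kc] := fconnect_chain mc mk.
  by rewrite (connect_trans ac ck) in nak.
by rewrite (connect_trans bk kc) in nbc.
Qed.

(** The formula that recovers any entry from a column below [a]. *)
Lemma shared_res_min a m b : fconnect p m a ->
  shared_res a b = Num.min (shared_res a m) (shared_res b m).
Proof.
move=> ma; have Xam := shared_res_ancestor ma.
apply/le_anti; rewrite shared_res_ultrametric andbT le_min Xam shared_res_le /=.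
have := shared_res_ultrametric b m a.
rewrite [shared_res m a]shared_resC [shared_res b a]shared_resC Xam.
by rewrite ge_min => /orP[//|]; apply: le_trans; apply: shared_res_le.
Qed.

(** Otherwise the line above [a] is counted on the right only. *)
Lemma shared_res_eq_ancestor a b :
  shared_res a b = shared_res a a -> fconnect p b a.
Proof.
have [-> _ | a_neq0] := eqVneq a ord0; first exact: fconnect_root.
apply: contra_eqT => nba; rewrite lt_eqF //.
case: (unliftP ord0 a) a_neq0 nba => [i -> _ | -> /eqP//] nbi.
rewrite [ltRHS](bigD1 i) ?connect0 //=.
apply: (@le_lt_trans _ _ (\sum_(c | fconnect p (bus i) (bus c) &&
                      fconnect p (bus i) (bus c) && (c != i)) w 0 c)).
  apply: ler_sum_weights => c /andP[-> bc] /=.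
  by apply: contraNneq nbi => <-.
by rewrite ltrDr.
Qed.

Lemma shared_res_inj a b : shared_res a b = shared_res a a ->
  shared_res a b = shared_res b b -> a = b.
Proof.
move=> /shared_res_eq_ancestor ba; rewrite shared_resC => /shared_res_eq_ancestor ab.
exact: fconnect_anti.
Qed.

End SharedResistance.
End ParentMap.

(** The hypothesis that [F] meets the descendants of every node concerns the
    first tree only: equality of the columns transfers it to the second. *)
Lemma shared_res_determined (R : realType) (N : nat)
    (p p' : 'I_N.+1 -> 'I_N.+1) (d d' : 'I_N.+1 -> nat) (w w' : 'rV[R]_N)
    (F : {set 'I_N.+1}) :
    parent_map p d -> parent_map p' d' ->
    (forall c, 0 < w 0 c) -> (forall c, 0 < w' 0 c) ->
    (forall a, exists2 m, m \in F & fconnect p m a) ->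
    (forall a m, m \in F -> shared_res p w a m = shared_res p' w' a m) ->
  forall a b, shared_res p w a b = shared_res p' w' a b.
Proof.
move=> pm pm' w0 w0' coverF eqF.
set X := shared_res p w; set Y := shared_res p' w'.
have {}eqF a m : m \in F -> X a m = Y a m := eqF a m.
(* Of two nodes with the same columns, take the one with the larger diagonal
   entry: its descendant m in F is then a descendant of both. *)
have separate a b : (forall m, m \in F -> X a m = X b m) -> a = b.
  wlog le_ba : a b / X b b <= X a a.
    move=> IH eqab; have [|/ltW] := leP (X b b) (X a a) => le; first exact: IH.
    by apply/esym/IH => // m /eqab.
  move=> eqab; have [m mF ma] := coverF a.
  have Xam : X a m = X a a := shared_res_ancestor w ma.
  have Xbm : X b m = X a a by rewrite -eqab.
  have Xbb : X b b = X a a.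
    by apply/le_anti; rewrite le_ba -Xbm; apply: shared_res_le.
  have Xab : X a b = X a a.
    apply/le_anti; rewrite (shared_res_le p w0) /=.
    by have := shared_res_ultrametric p w0 a b m; rewrite -/X Xam Xbm minxx.
  by apply: (shared_res_inj pm w0); rewrite -/X ?Xbb.
(* If F misses the descendants of a in the second tree, the columns of F do
   not separate a from its parent there. *)
have coverF' a : exists2 m, m \in F & fconnect p' m a.
  have [/exists_inP//|] := boolP [exists m in F, fconnect p' m a].
  rewrite negb_exists => /forallP nF'.
  have {nF'} nF m (mF : m \in F) : ~~ fconnect p' m a.
    by have := nF' m; rewrite mF.
  have a_neq0 : a != ord0.
    have [m mF _] := coverF a.
    by apply: contraNneq (nF m mF) => ->; apply: fconnect_root pm' _.
  have := pm'.2 a a_neq0; rewrite (separate (p' a) a) ?ltnn // => m mF.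
  rewrite !eqF //; apply: shared_res_parent; exact: nF.
move=> a b; have [m mF m'a] := coverF' a.
(* A node of F below a in the second tree maximizes the row of a over F, so it
   lies below a in the first tree as well. *)
have ma : fconnect p m a.
  apply: (shared_res_eq_ancestor pm w0).
  apply/le_anti; rewrite (shared_res_le p w0) /= -/X.
  have [k kF ka] := coverF a.
  have Xak : X a k = X a a := shared_res_ancestor w ka.
  have Yam : Y a m = Y a a := shared_res_ancestor w' m'a.
  by rewrite -Xak !eqF // Yam; apply: shared_res_le.
have -> : X a b = _ := shared_res_min w0 b ma.
have -> : Y a b = _ := shared_res_min w0' b m'a.
by rewrite -[X in Num.min X]/(X a m) -[X in Num.min _ X]/(X b m) !eqF.
Qed.

(** * Inverses of diagonal and positive definite matrices *)

Section Inverse.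
Variable R : realType.

Lemma invmx_unique n (A B : 'M[R]_n) : A *m B = 1%:M -> invmx A = B.
Proof.
move=> AB; have [A_unit _] := mulmx1_unit AB.
by rewrite -[RHS](mulKmx A_unit) AB mulmx1.
Qed.

Lemma diag_mx_pos_unit n (r : 'rV[R]_n) :
  (forall l, 0 < r 0 l) -> diag_mx r \in unitmx.
Proof.
move=> r_gt0; rewrite unitmxE det_diag unitfE prodf_seq_neq0.
by apply/allP => l _; rewrite gt_eqF.
Qed.

Lemma invmx_diag n (r : 'rV[R]_n) : (forall l, 0 < r 0 l) ->
  invmx (diag_mx r) = diag_mx (\row_l (r 0 l)^-1).
Proof.
move=> r_gt0; apply: invmx_unique; apply/matrixP => i j.
rewrite mulmx_diag !mxE; case: eqP => // _.
by rewrite mulfV // gt_eqF.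
Qed.

Lemma posdef_unit n (Th : 'M[R]_n) : posdef Th -> Th \in unitmx.
Proof.
case=> Th_sym Th_pos; rewrite -row_free_unit -kermx_eq0.
apply/rowV0P => v /sub_kermxP vTh; apply/eqP; apply: contraT => v_neq0.
have := Th_pos v^T; rewrite trmxK vTh mul0mx mxE ltxx -trmx0.
by rewrite (inj_eq (can_inj (@trmxK _ _ _))) => /(_ v_neq0).
Qed.
End Inverse.

(** * Laplacians of weighted graphs *)

Section Laplacian.
Variables (R : realType) (N : nat).
Implicit Types (Th : 'M[R]_N) (L : 'M[R]_N.+1) (At : 'M[R]_(N, N.+1)) (r : 'rV[R]_N).
Implicit Types (e : rel 'I_N.+1).

Definition laplacian At r : 'M[R]_N.+1 := At^T *m invmx (diag_mx r) *m At.

Lemma laplacianE At r i j : (forall l, 0 < r 0 l) ->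
  laplacian At r i j = \sum_l (r 0 l)^-1 * (At l i * At l j).
Proof.
move=> r_gt0; rewrite /laplacian invmx_diag // mul_mx_diag mxE.
by apply: eq_bigr => l _; rewrite !mxE mulrAC mulrC.
Qed.

Lemma reduced_laplacianE At r i j : (forall l, 0 < r 0 l) ->
  reduced_laplacian At r i j = laplacian At r (bus i) (bus j).
Proof.
move=> r_gt0; rewrite laplacianE // /reduced_laplacian invmx_diag // mul_mx_diag mxE.
by apply: eq_bigr => l _; rewrite !mxE mulrAC mulrC.
Qed.

Lemma laplacianC At r i j : (forall l, 0 < r 0 l) ->
  laplacian At r i j = laplacian At r j i.
Proof.
move=> r_gt0; rewrite !laplacianE //.
by apply: eq_bigr => l _; rewrite [At l i * _]mulrC.
Qed.

Lemma line_joins_sym At l m n : line_joins At l m n -> line_joins At l n m.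
Proof. by case; [right | left]. Qed.

(** The sign [s] records the orientation of the line. *)
Lemma line_joins_entry At l m n : line_joins At l m n ->
  exists2 s : R, s * s = 1 & forall i, At l i = s * ((i == m)%:R - (i == n)%:R).
Proof.
have entry m' n' : row l At = delta_mx 0 m' - delta_mx 0 n' ->
    forall i, At l i = (i == m')%:R - (i == n')%:R.
  by move=> rowE i; have := congr1 (fun M : 'rV_N.+1 => M 0 i) rowE; rewrite !mxE.
case=> /entry At_l; [exists 1 | exists (-1)]; rewrite ?mulrNN ?mulr1 // => i.
  by rewrite mul1r.
by rewrite mulN1r opprB.
Qed.

Lemma line_joins_prod At l m n i j : line_joins At l m n ->
  At l i * At l j =
    ((i == m)%:R - (i == n)%:R) * ((j == m)%:R - (j == n)%:R).
Proof.
by case/line_joins_entry => s ss At_l; rewrite !At_l mulrACA ss mul1r.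
Qed.

Lemma line_joins_prod_neq0 At l m n i j : line_joins At l m n -> i != j ->
  At l i * At l j != 0 -> (i = m /\ j = n) \/ (i = n /\ j = m).
Proof.
move=> /line_joins_prod -> i_neq_j; rewrite mulf_eq0 negb_or.
have [im|im] := eqVneq i m; have [jn|jn] := eqVneq j n; first by left.
- have [jm|] := eqVneq j m; last by rewrite subrr eqxx andbF.
  by rewrite im jm eqxx in i_neq_j.
- have [i_n|] := eqVneq i n; last by rewrite subrr eqxx.
  by rewrite i_n jn eqxx in i_neq_j.
- have [->|] := eqVneq i n; last by rewrite subrr eqxx.
  have [->|] := eqVneq j m; last by rewrite subrr eqxx andbF.
  by right.
Qed.

Lemma line_joins_same At l m n i j : line_joins At l m n ->
  line_joins At l i j -> i != j -> (i = m /\ j = n) \/ (i = n /\ j = m).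
Proof.
move=> jmn jij i_neq_j; apply: (line_joins_prod_neq0 jmn) => //.
rewrite (line_joins_prod _ _ jij) !eqxx [j == i]eq_sym (negbTE i_neq_j).
by rewrite subr0 sub0r mul1r oppr_eq0 oner_eq0.
Qed.

Section Incidence.
Variables (e : rel 'I_N.+1) (At : 'M[R]_(N, N.+1)) (r : 'rV[R]_N).
Hypotheses (e_simple : simple_graph e) (At_inc : incidence_matrix e At).
Hypothesis r_gt0 : forall l, 0 < r 0 l.

Lemma edge_neq i j : e i j -> i != j.
Proof. by apply: contraTneq => ->; rewrite e_simple.2. Qed.

Lemma laplacian_edge l i j : e i j -> line_joins At l i j ->
  laplacian At r i j = - (r 0 l)^-1.
Proof.
move=> eij jlij; have i_neq_j := edge_neq eij.
rewrite laplacianE // (bigD1 l) //= big1 ?addr0 => [|k k_neq_l].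
  rewrite (line_joins_prod _ _ jlij) !eqxx [j == i]eq_sym (negbTE i_neq_j).
  by rewrite subr0 sub0r mul1r mulrN1.
apply/eqP; rewrite mulf_eq0; apply/orP; right.
apply: contraNT k_neq_l => nz; have [m [n [emn jkmn]]] := At_inc.1 k.
have [l' [_ uniq_l]] := At_inc.2 i j eij.
rewrite -(uniq_l l jlij); apply/eqP/esym/uniq_l.
by have [[-> ->]|[-> ->]] := line_joins_prod_neq0 jkmn i_neq_j nz => //; apply: line_joins_sym.
Qed.

Lemma laplacian_nonedge i j : i != j -> ~~ e i j -> laplacian At r i j = 0.
Proof.
move=> i_neq_j neij; rewrite laplacianE // big1 // => k _.
apply/eqP; rewrite mulf_eq0; apply/orP; right.
apply: contraNT neij => nz; have [m [n [emn jkmn]]] := At_inc.1 k.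
have [[-> ->]|[-> ->]] := line_joins_prod_neq0 jkmn i_neq_j nz => //.
by rewrite e_simple.1.
Qed.

Lemma incidence_row_sum l : \sum_i At l i = 0.
Proof.
have [m [n [_ /line_joins_entry[s _ At_l]]]] := At_inc.1 l.
rewrite (eq_bigr _ (fun i _ => At_l i)) -mulr_sumr sumrB.
have sum1 k : \sum_(i < N.+1) ((i == k)%:R : R) = 1.
  by rewrite (bigD1 k) //= eqxx big1 ?addr0 // => i /negbTE ->.
by rewrite !sum1 subrr mulr0.
Qed.

Lemma laplacian_row_sum i : \sum_j laplacian At r i j = 0.
Proof.
under eq_bigr do rewrite laplacianE //.
rewrite exchange_big /= big1 // => l _.
by rewrite -!mulr_sumr incidence_row_sum !mulr0.
Qed.

(** Each line gives two ordered pairs of adjacent nodes, and each such pair comes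
    from a single line. *)
Lemma card_edges : #|[set ij : 'I_N.+1 * 'I_N.+1 | e ij.1 ij.2]| = (2 * N)%N.
Proof.
have /fin_all_exists[f f_ends] : forall l, exists mn : 'I_N.+1 * 'I_N.+1,
    e mn.1 mn.2 /\ line_joins At l mn.1 mn.2.
  by move=> l; have [m [n ?]] := At_inc.1 l; exists (m, n).
pose g (lb : 'I_N * bool) :=
  if lb.2 then f lb.1 else ((f lb.1).2, (f lb.1).1).
have g_ends l b : e (g (l, b)).1 (g (l, b)).2 /\
    line_joins At l (g (l, b)).1 (g (l, b)).2.
  have [? ?] := f_ends l; case: b => //=; split; first by rewrite e_simple.1.
  exact: line_joins_sym.
have g_inj : injective g.
  move=> [l b] [k c] g_eq; have lk : l = k.
    have [el jl] := g_ends l b; have [_ jk] := g_ends k c.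
    have [l' [_ uniq_l]] := At_inc.2 _ _ el.
    by rewrite -(uniq_l l jl) -(uniq_l k) // g_eq.
  move: g_eq; rewrite -lk => g_eq; congr (_, _).
  have := edge_neq (f_ends l).1; move: g_eq; rewrite /g /=.
  by case: b c (f l) => -[] [m n] //= [-> _]; rewrite eqxx.
have -> : [set ij | e ij.1 ij.2] = [set g lb | lb in [set: 'I_N * bool]].
  apply/setP => -[i j]; rewrite inE /=; apply/idP/imsetP => [eij | [[l b] _ E]].
    have [l [jl _]] := At_inc.2 i j eij; have [_ jl'] := f_ends l.
    have := line_joins_same jl' jl (edge_neq eij).
    by case=> -[-> ->]; [exists (l, true) | exists (l, false)]; rewrite ?inE // /g /=; case: (f l).
  by have := (g_ends l b).1; rewrite -E.
by rewrite card_imset // cardsT card_prod card_ord card_bool mulnC.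
Qed.
End Incidence.

Lemma extended_laplacian_bus Th i j :
  extended_laplacian Th (bus i) (bus j) = Th i j.
Proof. by rewrite -!rshift1 block_mxEdr. Qed.

Lemma extended_laplacian_root Th i :
  extended_laplacian Th (bus i) ord0 = - (Th *m ones R N) i 0.
Proof.
rewrite -rshift1 (_ : ord0 = lshift N (0 : 'I_1)); last exact/val_inj.
by rewrite block_mxEdl mxE.
Qed.

Lemma extended_laplacianC Th i j : Th^T = Th ->
  extended_laplacian Th i j = extended_laplacian Th j i.
Proof.
move=> Th_sym; have : (extended_laplacian Th)^T = extended_laplacian Th.
  rewrite /extended_laplacian tr_block_mx !linearN /=.
  by rewrite !trmx_mul !trmxK Th_sym mulmxA.
by move=> /matrixP/(_ j i); rewrite mxE.
Qed.

Lemma extended_laplacian_row_sum Th i : \sum_j extended_laplacian Th i j = 0.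
Proof.
have : extended_laplacian Th *m (col_mx 1%:M (ones R N) : 'cV_(1 + N)) = 0.
  rewrite /extended_laplacian mul_block_col !mulmx1 !mulNmx subrr addNr.
  exact: col_mx0.
move/matrixP/(_ i 0); rewrite !mxE => E; rewrite -[RHS]E.
apply: eq_bigr => j _; have -> : col_mx 1%:M (ones R N) = const_mx 1 :> 'cV_(1 + N).
  rewrite -[RHS]vsubmxK; congr col_mx; apply/matrixP => a b; rewrite !mxE //.
  by rewrite !ord1.
by rewrite [X in _ * X]mxE mulr1.
Qed.

(** The diagonal entries are minus the sums of the others. *)
Lemma zero_row_sum_eq L L' :
  (forall i, \sum_j L i j = 0) -> (forall i, \sum_j L' i j = 0) ->
  (forall i j, i != j -> L i j = L' i j) -> L = L'.
Proof.
move=> L0 L'0 offdiag; apply/matrixP => i j.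
have [<-|] := eqVneq i j; last exact: offdiag.
have : \sum_k L i k = \sum_k L' i k by rewrite L0 L'0.
rewrite (bigD1 i) //= [in RHS](bigD1 i) //= [X in _ = _ + X](eq_bigr (L i)).
  exact: addIr.
by move=> k k_neq_i; rewrite offdiag // eq_sym.
Qed.

(** Deleting the root loses nothing: its row and column are recovered from
    symmetry and zero row sums. *)
Lemma extended_reduced_laplacian e At r :
  incidence_matrix e At -> (forall l, 0 < r 0 l) ->
  extended_laplacian (reduced_laplacian At r) = laplacian At r.
Proof.
move=> At_inc r_gt0; set Th := reduced_laplacian At r.
have lap0 := laplacian_row_sum At_inc r_gt0.
have Th_sym : Th^T = Th.
  apply/matrixP => i j; rewrite mxE !reduced_laplacianE //.
  exact: laplacianC.
have root i : extended_laplacian Th (bus i) ord0 = laplacian At r (bus i) ord0.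
  rewrite extended_laplacian_root; apply/eqP; rewrite eq_sym -addr_eq0.
  apply/eqP; apply: etrans (lap0 (bus i)); rewrite big_ord_recl; congr (_ + _).
  rewrite mxE; apply: eq_bigr => j _.
  by rewrite [ones _ _ _ _]mxE mulr1 reduced_laplacianE.
apply: zero_row_sum_eq => // [|i j]; first exact: extended_laplacian_row_sum.
case: (unliftP ord0 i) => [a ->|->]; case: (unliftP ord0 j) => [b ->|->] // _.
- by rewrite extended_laplacian_bus reduced_laplacianE.
- by rewrite extended_laplacianC // laplacianC.
Qed.

End Laplacian.

(** * The Laplacian of a parent map and its inverse *)

Section ParentMatrix.
Variables (R : realType) (N : nat).
Variables (p : 'I_N.+1 -> 'I_N.+1) (d : 'I_N.+1 -> nat).
Hypothesis pm : parent_map p d.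

Definition parent_rel : rel 'I_N.+1 :=
  fun i j => (i != j) && ((p i == j) || (p j == i)).

Definition parent_mx : 'M[R]_(N, N.+1) :=
  \matrix_(l, i) ((i == bus l)%:R - (i == p (bus l))%:R).

Lemma parent_rel_simple : simple_graph parent_rel.
Proof.
split=> [i j|i]; rewrite /parent_rel; last by rewrite eqxx.
by rewrite eq_sym orbC.
Qed.

Lemma parent_rel_parent i : i != ord0 -> parent_rel i (p i).
Proof.
move=> /pm.2 lt_d; rewrite /parent_rel eqxx andbT.
by apply: contraTneq lt_d => <-; rewrite ltnn.
Qed.

Lemma parent_mx_joins l : line_joins parent_mx l (bus l) (p (bus l)).
Proof. by left; apply/rowP => i; rewrite !mxE. Qed.

Lemma parent_mx_incidence : incidence_matrix parent_rel parent_mx.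
Proof.
have joins := parent_mx_joins.
split=> [l|m n]; first by exists (bus l), (p (bus l)); split; first exact: parent_rel_parent.
have one m' n' : m' != n' -> p m' = n' -> exists! l, line_joins parent_mx l m' n'.
  case: (unliftP ord0 m') => [l -> neq E|-> neq]; last by rewrite pm.1 => /eqP; rewrite (negbTE neq).
  exists l; split=> [|k jk]; first by rewrite -E.
  have [[/lift_inj-> //]|[E1 E2]] := line_joins_same (joins k) jk neq.
  have lt1 : (d n' < d (bus l))%N by rewrite -E pm.2.
  have : (d (bus l) < d n')%N by rewrite E1 E2 pm.2.
  by move/ltn_trans/(_ lt1); rewrite ltnn.
case/andP=> neq /orP[/eqP | /eqP E]; first exact: one.
have [|l [jl uniq_l]] := one n m _ E; first by rewrite eq_sym.
exists l; split=> [|k jk]; first exact: line_joins_sym.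
by apply: uniq_l; apply: line_joins_sym.
Qed.

Section Weights.
Variable w : 'rV[R]_N.
Hypothesis w_gt0 : forall c, 0 < w 0 c.

(** The reduced Laplacian is B^T diag(w)^-1 B, where B maps a potential to its
    drops towards the parents; the inverse of B is the ancestor matrix U. *)
Lemma invmx_parent_laplacian a b :
  invmx (reduced_laplacian parent_mx w) a b = shared_res p w (bus a) (bus b).
Proof.
pose U : 'M[R]_N := \matrix_(i, c) (fconnect p (bus i) (bus c))%:R.
pose B := col' ord0 parent_mx.
have BU : B *m U = 1%:M.
  apply/matrixP => i c; rewrite !mxE.
  under eq_bigr do rewrite !mxE (inj_eq lift_inj) mulrBl.
  rewrite sumrB (bigD1 i) //= eqxx mul1r big1 ?addr0; last first.
    by move=> k /negbTE ->; rewrite mul0r.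
  have -> : \sum_j (bus j == p (bus i))%:R * (fconnect p (bus j) (bus c))%:R =
            (fconnect p (p (bus i)) (bus c))%:R :> R.
    case: (unliftP ord0 (p (bus i))) => [k ->|->].
      rewrite (bigD1 k) //= eqxx mul1r big1 ?addr0 // => j.
      by rewrite (inj_eq lift_inj) => /negbTE ->; rewrite mul0r.
    by rewrite (fconnect_from_root pm) big1 // => j _; rewrite mul0r.
  rewrite (fconnect_eqVf p (bus i)) (inj_eq lift_inj).
  case: eqVneq => [<-|_]; last by rewrite subrr.
  by rewrite (negbTE (fconnect_parentN pm _)) // subr0.
have -> : shared_res p w (bus a) (bus b) = (U *m diag_mx w *m U^T) a b.
  rewrite mul_mx_diag mxE /shared_res big_mkcond; apply: eq_bigr => c _.
  rewrite !mxE; case: (fconnect p (bus a) _); case: (fconnect p (bus b) _);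
  by rewrite ?mul1r ?mul0r ?mulr1 ?mulr0.
congr (fun_of_matrix _ a b); apply: invmx_unique.
rewrite /reduced_laplacian -/B -!mulmxA (mulmxA B) BU mul1mx (mulmxA (invmx _)).
by rewrite mulVmx ?diag_mx_pos_unit // mul1mx -trmx_mul (mulmx1C BU) trmx1.
Qed.
End Weights.
End ParentMatrix.

(** * Trees underlying feasible matrices *)

(** Breadth-first search: [d] is the distance from the root, and [p i] the last
    node but one of a shortest walk to [i]. *)
Lemma connected_parent_map (N : nat) (s : rel 'I_N.+1) :
  (forall i, connect s ord0 i) ->
  exists p d, parent_map p d /\ forall i, i != ord0 -> s (p i) i.
Proof.
move=> conn.
pose walk i n := [exists t : n.-tuple 'I_N.+1, path s ord0 t && (last ord0 t == i)].
have /fin_all_exists[d d_min] i : exists n, walk i n /\ forall k, walk i k -> (n <= k)%N.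
  have ex_walk : exists n, walk i n.
    have /connectP[t st ->] := conn i; exists (size t).
    by apply/existsP; exists (in_tuple t); rewrite st eqxx.
  by case: (ex_minnP ex_walk) => n wn min_n; exists n.
have /fin_all_exists[p p_prop] i : exists j, (i = ord0 -> j = ord0) /\
    (i != ord0 -> s j i /\ (d j < d i)%N).
  have [-> | i_neq0] := eqVneq i ord0; first by exists ord0.
  have [/existsP[[t /= /eqP size_t] /andP[st /eqP last_t]] _] := d_min i.
  case/lastP: t => [|t k] in size_t st last_t.
    by rewrite -last_t eqxx in i_neq0.
  rewrite last_rcons in last_t; rewrite last_t in size_t st.
  exists (last ord0 t); split=> [i0|_]; first by rewrite i0 eqxx in i_neq0.
  rewrite rcons_path in st; case/andP: st => st ->; split=> //.
  rewrite -size_t size_rcons ltnS; apply: (d_min _).2.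
  by apply/existsP; exists (in_tuple t); rewrite st eqxx.
exists p, d; split; first split; first exact: (p_prop _).1.
- by move=> i /(p_prop i).2[].
- by move=> i /(p_prop i).2[].
Qed.

Section Feasible.
Variables (R : realType) (N : nat).
Implicit Types (Th : 'M[R]_N) (G : 'M[bool]_N.+1).

Definition support_rel Th : rel 'I_N.+1 :=
  fun i j => (i != j) && (extended_laplacian Th i j != 0).

(** If some nodes were unreachable from the root, the quadratic form of [Th]
    would vanish at the indicator vector of these nodes. *)
Lemma posdef_connected Th : posdef Th -> forall i, connect (support_rel Th) ord0 i.
Proof.
case=> Th_sym Th_pos i; apply/negPn/negP => nconn.
pose out j := ~~ connect (support_rel Th) ord0 j.
have L_zero j k : out j -> ~~ out k -> extended_laplacian Th j k = 0.
  rewrite negbK => oj ck; apply: contraNeq (oj) => nz.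
  apply: (connect_trans ck); apply: connect1; apply/andP; split.
    by apply: contraTneq ck => ->.
  by rewrite extended_laplacianC.
pose x : 'cV[R]_N := \col_j (out (bus j))%:R.
have x_neq0 : x != 0.
  case: (unliftP ord0 i) nconn => [j ->|->]; last by rewrite connect0.
  move=> oj; apply/eqP => /matrixP/(_ j 0); rewrite !mxE /out oj => /eqP.
  by rewrite oner_eq0.
have := Th_pos x x_neq0; suff -> : (x^T *m Th *m x) 0 0 = 0 by rewrite ltxx.
rewrite -mulmxA mxE big1 // => j _; rewrite !mxE.
have [oj|] := boolP (out (bus j)); last by rewrite mul0r.
rewrite mul1r -[RHS](extended_laplacian_row_sum Th (bus j)) big_ord_recl.
rewrite [X in _ = X + _]L_zero //; last by rewrite negbK connect0.
rewrite add0r; apply: eq_bigr => k _; rewrite mxE.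
rewrite -[Th j k]extended_laplacian_bus.
have [ok|nk] := boolP (out (bus k)); first by rewrite mulr1.
by rewrite mulr0 L_zero.
Qed.

Lemma norm0off_support Th : norm0off (extended_laplacian Th) =
  #|[set ij : 'I_N.+1 * 'I_N.+1 | support_rel Th ij.1 ij.2]|.
Proof. by []. Qed.

(** In terms of the extended Laplacian, the conditions on the row sums are the
    conditions on the off-diagonal entries for the lines at the root. *)
Lemma feasM_extended G Th : G^T = G ->
  feasM G Th <-> Th^T = Th /\ forall i j, i != j ->
    extended_laplacian Th i j <= 0 /\ (G i j = false -> extended_laplacian Th i j = 0).
Proof.
move=> G_sym; have GC i j : G i j = G j i by rewrite -[in LHS]G_sym mxE.
split=> [[Th_sym Th_off Th_row] | [Th_sym ext_off]].
  split=> // i j.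
  have root n : extended_laplacian Th (bus n) ord0 <= 0 /\
      (G (bus n) ord0 = false -> extended_laplacian Th (bus n) ord0 = 0).
    rewrite extended_laplacian_root oppr_le0 GC.
    have [Gpos G0] := Th_row n.
    by case: (G ord0 (bus n)) Gpos G0 => [/(_ erefl) + _|_ /(_ erefl) ->];
      rewrite ?oppr0.
  case: (unliftP ord0 i) => [m ->|->]; case: (unliftP ord0 j) => [n ->|->] //.
  - rewrite extended_laplacian_bus (inj_eq lift_inj) => /Th_off[Gneg G0].
    by case: (G (bus m) (bus n)) Gneg G0 => [/(_ erefl) + _|_ /(_ erefl) ->].
  - by rewrite extended_laplacianC // GC.
split=> // [m n m_neq_n | n].
  have := ext_off (bus m) (bus n); rewrite extended_laplacian_bus (inj_eq lift_inj).
  by case/(_ m_neq_n) => ? ?; split.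
have := ext_off (bus n) ord0 isT; rewrite extended_laplacian_root GC oppr_le0.
case=> ? z; split=> // /z /eqP; rewrite oppr_eq0; exact: eqP.
Qed.

(** The parent edges lie in the support and number N, as many as the support
    has; so they are all of it. *)
Lemma feasible_parent_map G Th : G^T = G -> feasM G Th -> feasT Th ->
  exists p d (w : 'rV[R]_N), [/\ parent_map p d, forall c, 0 < w 0 c,
    support_rel Th =2 parent_rel p & Th = reduced_laplacian (parent_mx R p) w].
Proof.
move=> G_sym /(feasM_extended _ G_sym)[Th_sym Th_off] [card_Th Th_pd].
have [p [d [pm p_supp]]] := connected_parent_map (posdef_connected Th_pd).
set L := extended_laplacian Th in Th_off.
have L_sym i j : L i j = L j i.
  exact: extended_laplacianC.
have supp_sym i j : support_rel Th i j = support_rel Th j i.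
  by rewrite /support_rel eq_sym L_sym.
have suppE : support_rel Th =2 parent_rel p.
  move=> i j.
  have sub : [set ij : 'I_N.+1 * 'I_N.+1 | parent_rel p ij.1 ij.2] \subset
             [set ij : 'I_N.+1 * 'I_N.+1 | support_rel Th ij.1 ij.2].
    apply/subsetP => -[m n]; rewrite !inE /= => /andP[neq].
    have supp k : k != p k -> support_rel Th k (p k).
      rewrite supp_sym => neqk; apply: p_supp.
      by apply: contraNneq neqk => ->; rewrite pm.1.
    case/orP=> /eqP E; first by rewrite -E supp // E.
    by rewrite supp_sym -E supp // E eq_sym.
  have : #|[set ij : 'I_N.+1 * 'I_N.+1 | support_rel Th ij.1 ij.2]| =
         #|[set ij : 'I_N.+1 * 'I_N.+1 | parent_rel p ij.1 ij.2]|.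
    rewrite -norm0off_support card_Th.
    by rewrite (card_edges (parent_rel_simple p) (parent_mx_incidence R pm)).
  move=> card_eq; have /(_ (i, j)) := elimT (subset_cardP (esym card_eq)) sub.
  by rewrite !inE.
pose w : 'rV[R]_N := \row_c (- L (bus c) (p (bus c)))^-1.
have w_gt0 c : 0 < w 0 c.
  rewrite mxE invr_gt0 oppr_gt0.
  have /andP[neq nz] : support_rel Th (bus c) (p (bus c)).
    by rewrite suppE; apply: parent_rel_parent pm _ _.
  by rewrite lt_neqAle nz (Th_off _ _ neq).1.
exists p, d, w; split=> //.
have inc := parent_mx_incidence R pm; have simple := parent_rel_simple p.
suff LE : L = laplacian (parent_mx R p) w.
  by apply/matrixP => i j; rewrite reduced_laplacianE // -LE extended_laplacian_bus.
apply: zero_row_sum_eq => [i|i|i j neq].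
- exact: extended_laplacian_row_sum.
- exact: laplacian_row_sum inc w_gt0 i.
have value c : L (bus c) (p (bus c)) = laplacian (parent_mx R p) w (bus c) (p (bus c)).
  rewrite (laplacian_edge simple inc w_gt0 _ (parent_mx_joins R p c)) ?mxE ?invrK ?opprK //.
  exact: parent_rel_parent pm _ _.
have [|nij] := boolP (parent_rel p i j); last first.
  rewrite (laplacian_nonedge simple inc w_gt0 neq nij).
  by move: nij; rewrite -suppE /support_rel neq negbK => /eqP.
case/andP=> _ /orP[] /eqP E.
  rewrite -E; case: (unliftP ord0 i) => [c -> //|i0].
  by rewrite -E i0 pm.1 eqxx in neq.
rewrite laplacianC // L_sym -E.
case: (unliftP ord0 j) => [c -> //|j0].
by rewrite -E j0 pm.1 eqxx in neq.
Qed.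
End Feasible.

(** * Feasibility of the Laplacian of the grid *)

Section TrueGrid.
Variables (R : realType) (N : nat).
Variables (e : rel 'I_N.+1) (At : 'M[R]_(N, N.+1)) (r : 'rV[R]_N).
Hypotheses (e_simple : simple_graph e) (e_conn : connected_graph e).
Hypotheses (At_inc : incidence_matrix e At) (r_gt0 : forall l, 0 < r 0 l).

Lemma support_reduced_laplacian : support_rel (reduced_laplacian At r) =2 e.
Proof.
move=> i j; rewrite /support_rel (extended_reduced_laplacian At_inc) //.
have [eij|nij] := boolP (e i j).
  rewrite (edge_neq e_simple eij) /=; have [l [jl _]] := At_inc.2 i j eij.
  by rewrite (laplacian_edge e_simple At_inc r_gt0 eij jl) oppr_eq0 invr_eq0 gt_eqF.
have [->|neq] := eqVneq i j; first by [].
by rewrite (laplacian_nonedge e_simple At_inc r_gt0 neq nij) eqxx.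
Qed.

Lemma reduced_laplacian_sym : (reduced_laplacian At r)^T = reduced_laplacian At r.
Proof.
by apply/matrixP => i j; rewrite mxE !reduced_laplacianE // laplacianC.
Qed.

(** The quadratic form is the sum of the squared drops along the lines divided
    by the resistances.  If it vanishes, the potential is constant on the
    connected graph, hence equal to its value 0 at the root. *)
Lemma reduced_laplacian_posdef : posdef (reduced_laplacian At r).
Proof.
split=> [|x x_neq0]; first exact: reduced_laplacian_sym.
pose A := col' ord0 At; pose drop := A *m x.
have -> : (x^T *m reduced_laplacian At r *m x) 0 0 =
          \sum_l (r 0 l)^-1 * drop l 0 ^+ 2.
  rewrite /reduced_laplacian -/A !mulmxA -trmx_mul -mulmxA invmx_diag //.
  rewrite mul_mx_diag mxE; apply: eq_bigr => l _.
  by rewrite -/drop [X in X * _]mxE [drop^T _ _]mxE [(\row__ _) _ _]mxE mulrAC mulrC expr2.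
have term_ge0 l : 0 <= (r 0 l)^-1 * drop l 0 ^+ 2.
  by rewrite mulr_ge0 ?sqr_ge0 // invr_ge0 ltW.
rewrite lt_neqAle sumr_ge0 // andbT eq_sym.
apply: contraNneq x_neq0 => /eqP; rewrite psumr_eq0 // => /allP drop0.
(* The potential x extended by 0 at the root. *)
pose y i := if unlift ord0 i is Some j then x j 0 else 0.
have y_edge m n : e m n -> y m = y n.
  move=> emn; have [l [jl _]] := At_inc.2 m n emn.
  have : drop l 0 = 0.
    have /implyP/(_ isT) := drop0 l (mem_index_enum l).
    by rewrite mulf_eq0 sqrf_eq0 invr_eq0 gt_eqF //= => /eqP.
  have -> : drop l 0 = \sum_i At l i * y i.
    rewrite mxE big_ord_recl /y unlift_none mulr0 add0r.
    by apply: eq_bigr => j _; rewrite liftK mxE.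
  have [s ss At_l] := line_joins_entry jl.
  have pick k : \sum_i (i == k)%:R * y i = y k.
    rewrite (bigD1 k) //= eqxx mul1r big1 ?addr0 // => i /negbTE ->.
    by rewrite mul0r.
  under eq_bigr do rewrite At_l -mulrA mulrBl.
  rewrite -mulr_sumr sumrB !pick => /eqP; rewrite mulf_eq0 => /orP[/eqP s0|].
    by move: ss; rewrite s0 mul0r => /eqP; rewrite eq_sym oner_eq0.
  by rewrite subr_eq0 => /eqP.
have y_closed : closed e [pred i | y i == 0] by move=> m n /y_edge; rewrite !inE => ->.
apply/eqP/colP => j; rewrite mxE.
have := closed_connect y_closed (e_conn ord0 (bus j)).
by rewrite !inE /y unlift_none liftK eqxx => /esym/eqP.
Qed.

Lemma reduced_laplacian_feasM (G : 'M[bool]_N.+1) : correct_prior e G ->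
  feasM G (reduced_laplacian At r).
Proof.
case=> G_sym G_e; apply/(feasM_extended _ G_sym); split; first exact: reduced_laplacian_sym.
move=> i j neq; rewrite (extended_reduced_laplacian At_inc) //.
have [eij|nij] := boolP (e i j); last first.
  by rewrite (laplacian_nonedge e_simple At_inc r_gt0 neq nij).
split=> [|/G_e]; last by rewrite eij.
have [l [jl _]] := At_inc.2 i j eij.
by rewrite (laplacian_edge e_simple At_inc r_gt0 eij jl) oppr_le0 invr_ge0 ltW.
Qed.

Lemma reduced_laplacian_feasT : feasT (reduced_laplacian At r).
Proof.
split; last exact: reduced_laplacian_posdef.
rewrite norm0off_support -(card_edges e_simple At_inc).
by apply: eq_card => ij; rewrite !inE support_reduced_laplacian.
Qed.
End TrueGrid.

(** The only neighbor of a childless [m] is its parent, so a path through [m]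
    that goes on would enter and leave [m] by the same node. *)
Lemma childless_leaf (N : nat) (e : rel 'I_N.+1) p m :
  irreflexive e -> p ord0 = ord0 -> e =2 parent_rel p ->
  (forall k, p k = m -> k = m) -> leaf e m.
Proof.
move=> e_irr p0 eE childless x [q [[walk uq <-] m_in]].
case/splitPl: m_in walk uq => q1 q2 last_q1.
rewrite cat_path last_q1 last_cat last_q1; case: q2 => [//|k q2] /and3P[walk1 emk _] uq.
have no_child j : e m j -> p m = j.
  rewrite eE => /andP[neq /orP[/eqP //|/eqP/childless E]].
  by rewrite E eqxx in neq.
have pmk := no_child k emk.
case/lastP: q1 => [|q1 m'] in last_q1 walk1 uq *.
  by move: emk; rewrite -pmk -last_q1 p0 e_irr.
rewrite last_rcons in last_q1; rewrite rcons_path last_q1 in walk1.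
case/andP: walk1 => _; rewrite eE (parent_rel_simple p).1 -eE => /no_child pmj.
move: uq; rewrite -cat_cons cat_uniq => /and3P[_ /hasPn/(_ k) + _].
rewrite inE eqxx => /(_ isT) /negP[].
by rewrite -pmk pmj -rcons_cons mem_rcons inE mem_last orbT.
Qed.

(** * Voltage data and the weighted norm *)

Section Estimation.
Variables (R : realType) (N T : nat) (C : {set 'I_N}) (D : 'M[R]_(#|C|, T)).
Implicit Types Th W : 'M[R]_N.

Lemma voltage_probed_columns Th Th' : \rank D = #|C| ->
  voltage Th D = voltage Th' D ->
  forall a c, c \in C -> invmx Th a c = invmx Th' a c.
Proof.
move=> rankD; rewrite /voltage => eqV a c cC.
have /matrixP/(_ a (enum_rank_in cC c)) :
    invmx Th *m probe_mx R C = invmx Th' *m probe_mx R C.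
  by apply: (row_free_inj (A := D)) eqV; rewrite /row_free rankD.
have column M : (M *m probe_mx R C) a (enum_rank_in cC c) = M a c.
  rewrite mxE (bigD1 c) //= big1 ?addr0 => [|i /negbTE neq].
    by rewrite mxE enum_rankK_in // eqxx mulr1.
  by rewrite mxE enum_rankK_in // neq mulr0.
by rewrite !column.
Qed.

Lemma sqnormW_col W (X : 'M[R]_(N, T)) :
  sqnormW W X = \sum_t ((col t X)^T *m W *m col t X) 0 0.
Proof.
rewrite /sqnormW /mxtrace; apply: eq_bigr => t _.
rewrite !mxE; apply: eq_bigr => i _; rewrite !mxE; congr (_ * _).
by apply: eq_bigr => j _; rewrite !mxE.
Qed.

Lemma posdef_ge0 W (x : 'cV[R]_N) : posdef W -> 0 <= (x^T *m W *m x) 0 0.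
Proof.
move=> [_ W_pos]; have [->|/W_pos/ltW//] := eqVneq x 0.
by rewrite mulmx0 mxE.
Qed.

Lemma sqnormW_ge0 W (X : 'M[R]_(N, T)) : posdef W -> 0 <= sqnormW W X.
Proof.
by move=> W_pd; rewrite sqnormW_col sumr_ge0 // => t _; apply: posdef_ge0.
Qed.

Lemma sqnormW_eq0 W (X : 'M[R]_(N, T)) : posdef W -> sqnormW W X = 0 -> X = 0.
Proof.
move=> W_pd /eqP; rewrite sqnormW_col psumr_eq0 => [/allP X0|t _]; last first.
  exact: posdef_ge0.
apply/matrixP => i t; rewrite mxE.
have /implyP/(_ isT) := X0 t (mem_index_enum t).
have [E _|/W_pd.2] := eqVneq (col t X) 0; last by move/gt_eqF=> ->.
by have /matrixP/(_ i 0) := E; rewrite !mxE.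
Qed.
End Estimation.

(** * Identifiability *)

Theorem theorem1 (R : realType) (N T : nat)
    (e : rel 'I_N.+1) (At : 'M[R]_(N, N.+1)) (r : 'rV[R]_N)
    (G : 'M[bool]_N.+1) (W : 'M[R]_N)
    (C : {set 'I_N}) (D : 'M[R]_(#|C|, T))
    (e_tree : is_tree e) (At_inc : incidence_matrix e At)
    (r_pos : forall l, 0 < r 0 l)
    (G_prior : correct_prior e G) (W_pd : posdef W)
    (D_rank : \rank D = #|C|)
    (leaves_probed : forall n, leaf e n -> n \in [set bus i | i in C]) :
  let Tho := reduced_laplacian At r in
  let V := voltage Tho D in
  (~ exists Th : 'M[R]_N,
       [/\ feasM G Th, feasT Th, Th != Tho & voltage Th D = V]) /\
  unique (minimizer (fun Th => feasM G Th /\ feasT Th) (objective W D V)) Tho.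
Proof.
move=> Tho V; have [e_simple e_conn _] := e_tree.
have TM : feasM G Tho := reduced_laplacian_feasM e_simple At_inc r_pos G_prior.
have TT : feasT Tho := reduced_laplacian_feasT e_simple e_conn At_inc r_pos.
have [p [d [w [pm w_gt0 suppE ThoE]]]] := feasible_parent_map G_prior.1 TM TT.
have covered a : exists2 m, m \in [set bus i | i in C] & fconnect p m a.
  have [m ma childless] := deepest_descendant pm a; exists m => //.
  apply: leaves_probed; apply: childless_leaf childless; first exact: e_simple.2.
    exact: pm.1.
  by move=> i j; rewrite -suppE (support_reduced_laplacian e_simple At_inc).
have identified Th : feasM G Th -> feasT Th -> voltage Th D = V -> Th = Tho.
  move=> fM fT eqV; rewrite -[LHS]invmxK -[RHS]invmxK; congr invmx.
  have [p' [d' [w' [pm' w'_gt0 _ ThE]]]] := feasible_parent_map G_prior.1 fM fT.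
  have entry a b : invmx Th a b = shared_res p' w' (bus a) (bus b).
    by rewrite ThE; apply: invmx_parent_laplacian pm' _ w'_gt0 _ _.
  have entryo a b : invmx Tho a b = shared_res p w (bus a) (bus b).
    by rewrite ThoE; apply: invmx_parent_laplacian pm _ w_gt0 _ _.
  apply/matrixP => a b; rewrite entry entryo; apply/esym.
  apply: (shared_res_determined pm pm' w_gt0 w'_gt0 covered) => {a b} a _ /imsetP[c cC ->].
  case: (unliftP ord0 a) => [i ->|->].
    by rewrite -entry -entryo (voltage_probed_columns D_rank eqV).
  by rewrite (shared_res_root pm) (shared_res_root pm').
have fit0 Th : Th \in unitmx -> Th *m voltage Th D - probe_mx R C *m D = 0.
  by move=> Th_unit; rewrite /voltage -mulmxA mulKVmx // subrr.
have obj_ge0 Th : 0 <= objective W D V Th.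
  by rewrite /objective mulr_ge0 ?invr_ge0 // sqnormW_ge0.
have obj0 : objective W D V Tho = 0.
  by rewrite /objective (fit0 _ (posdef_unit TT.2)) /sqnormW mulmx0 mxtrace0 mulr0.
split=> [[Th [fM fT /eqP neq eqV]]|]; first exact/neq/identified.
split=> [|Th [[fM fT] Th_min]].
  by split=> // Th _; rewrite obj0.
apply/esym/identified => //.
have obj_Th0 : objective W D V Th = 0.
  by apply/le_anti; rewrite obj_ge0 -obj0 Th_min.
have ThV : Th *m V = probe_mx R C *m D.
  apply/eqP; rewrite -subr_eq0; apply/eqP/(sqnormW_eq0 W_pd).
  move/eqP: obj_Th0; rewrite mulf_eq0 invr_eq0 pnatr_eq0 => /eqP; exact.
by rewrite /voltage -mulmxA -ThV mulKmx ?(posdef_unit fT.2).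
Qed.
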